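(* Let $X\subseteq U$ be a fixed set of $|X|=m$ keys and let $h:U\to[n]$ be a random simple tabulation hash function. Assume $m\le n$. For all $t\ge0$, $$\Pr\bigl[|h(X)|\ge\mu_0+t\bigr]=\exp\!\left(-\Omega\!\left(\min\left\{\frac{t^2}{m^{3-1/c}/n},\ \frac{t}{m^{1-1/c}}\right\}\right)\right),$$ and $$\Pr\bigl[|h(X)|\le\mu_0-t\bigr]=\exp\!\left(-\Omega\!\left(\min\left\{\frac{t^2}{m^{3-1/c}/n},\ \frac{t}{m^{1-1/c}}\right\}\right)\right)+O\!\left(\frac{m^2}{nt^2}\right).$$
   Context: Simple tabulation hashing: the key universe is $U=[u]$, each key $x\in U$ is viewed as a vector $(x[0],\dots,x[c-1])$ of $c=O(1)$ characters from $\Sigma=[u^{1/c}]$; the range is $[n]=[2^r]$. $h(x)=h_0(x[0])\oplus\cdots\oplus h_{c-1}(x[c-1])$ with $h_0,\dots,h_{c-1}:\Sigma\to[2^r]$ independent fully random functions and $\oplus$ bitwise XOR. $\mu_0=n(1-(1-1/n)^m)$. Constants in $O(\cdot),\Omega(\cdot)$ may depend on $c$ only. *)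

(* Defs.v *)
From HB Require Import structures.
From mathcomp Require Import all_boot all_order all_algebra.
From mathcomp Require Import all_classical all_reals all_analysis.
Set Implicit Arguments. Unset Strict Implicit. Unset Printing Implicit Defensive.
Import Order.TTheory GRing.Theory Num.Theory.
Local Open Scope ring_scope.

(* Keys: vectors of c characters from Sigma = [s]  (so u = s^c). *)
Definition key (c s : nat) := {ffun 'I_c -> 'I_s}.
(* Hash values in [2^r], represented as r-bit vectors. *)
Definition hval (r : nat) := {ffun 'I_r -> bool}.
(* A simple tabulation hash function: c character tables h_0..h_{c-1}. *)
Definition tabfun (c s r : nat) := {ffun 'I_c -> {ffun 'I_s -> hval r}}.

Definition tabhash (c s r : nat) (h : tabfun c s r) (x : key c s) : hval r :=
  [ffun b : 'I_r => \big[addb/false]_(i < c) (h i (x i) b)].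

Definition image_size (c s r : nat) (h : tabfun c s r) (X : {set key c s}) : nat :=
  #|[set tabhash h x | x in X]|.

Definition prob (R : realType) (c s r : nat) (E : pred (tabfun c s r)) : R :=
  (#|[set h : tabfun c s r | E h]|%:R) / (#|{: tabfun c s r}|%:R).

Definition mu0 (R : realType) (n m : nat) : R :=
  n%:R * (1 - (1 - (n%:R)^-1) ^+ m).

Definition tail_exponent (R : realType) (c n m : nat) (t : R) : R :=
  Num.min (t ^+ 2 / (m%:R `^ (3 - (c%:R)^-1) / n%:R))
          (t / (m%:R `^ (1 - (c%:R)^-1))).

(* Main.v *)
Require Import Defs.
From HB Require Import structures.
From mathcomp Require Import all_boot all_order all_algebra.
From mathcomp Require Import all_classical all_reals all_analysis.
From mathcomp Require Import ring lra.
Import Order.TTheory GRing.Theory Num.Theory.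
Local Open Scope ring_scope.

Set Implicit Arguments.
Unset Strict Implicit.
Unset Printing Implicit Defensive.

(** Write [F] for the fraction of bins [y] such that [y + D] misses the hash
    values of [X]; fully random hashing gives it mean [rho = (1 - |D|/n)^m].

    Second moment.  [F^2] is the average over [e] of the same fraction for
    [D :|: (D + e)], so the mean square deviation of [F] from [rho] is controlled
    by the biases alone.  Averaging over the table of one more position
    turns [F] into the product, over the characters of that position, of the
    fractions of the corresponding slices of [X], so the bias for k+1 positions is
    controlled by the biases and mean squares for k positions.  By induction both
    are O(m^2/n^3), whence E (|h(X)| - mu0)^2 = O(m^2/n): Chebyshev's inequality
    already gives the lower tail.

    Mean.  E |h(X)| <= mu0, because conditioned on bin 0 being missed by the
    other keys, a key hits bin 0 at most as often as any other bin.

    Upper tail.  Some position character occurs in at least one and at most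
    m^(1-1/c) keys; resampling its table entry last and iterating gives
    E exp(l (|h(X)| - mu0)) <= exp (l B + l^2 m^(3-1/c)/n) with bias
    B = m^(2-1/c)/n.  This settles t >= 2B, and Cantelli's inequality, fed with
    the mean and second moment bounds, settles t <= 2B. *)

(** * Averages over finite types *)

Section Average.
Context {R : realType}.

Definition avg (T : finType) (f : T -> R) : R := (\sum_t f t) / #|T|%:R.

Section Basics.
Variable T : finType.
Implicit Types f g : T -> R.

Lemma eq_avg f g : f =1 g -> avg f = avg g.
Proof. by move=> fg; rewrite /avg; under eq_bigr do rewrite fg. Qed.

Lemma avgD f g : avg (fun t => f t + g t) = avg f + avg g.
Proof. by rewrite /avg big_split /= mulrDl. Qed.

Lemma avgN f : avg (fun t => - f t) = - avg f.
Proof. by rewrite /avg sumrN mulNr. Qed.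

Lemma avgB f g : avg (fun t => f t - g t) = avg f - avg g.
Proof. by rewrite avgD avgN. Qed.

Lemma avgZl (k : R) f : avg (fun t => k * f t) = k * avg f.
Proof. by rewrite /avg -mulr_sumr mulrA. Qed.

Lemma avgZr (k : R) f : avg (fun t => f t * k) = avg f * k.
Proof. by rewrite /avg -mulr_suml mulrAC. Qed.

Lemma avg_sum (I : Type) (r : seq I) (P : pred I) (F : I -> T -> R) :
  avg (fun t => \sum_(i <- r | P i) F i t) = \sum_(i <- r | P i) avg (F i).
Proof. by rewrite /avg exchange_big /= mulr_suml. Qed.

Lemma ler_avg f g : (forall t, f t <= g t) -> avg f <= avg g.
Proof. by move=> fg; rewrite ler_wpM2r ?invr_ge0//; apply: ler_sum. Qed.

Lemma avg_ge0 f : (forall t, 0 <= f t) -> 0 <= avg f.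
Proof. by move=> f0; rewrite mulr_ge0 ?invr_ge0//; apply: sumr_ge0. Qed.

Lemma ler_norm_avg f : `|avg f| <= avg (fun t => `|f t|).
Proof.
rewrite /avg normrM [`|_^-1|]ger0_norm ?invr_ge0//.
by rewrite ler_wpM2r ?invr_ge0// ler_norm_sum.
Qed.

Lemma avg_cst (t0 : T) (k : R) : avg (fun _ : T => k) = k.
Proof.
rewrite /avg sumr_const -[k *+ _]mulr_natr mulfK// pnatr_eq0 -lt0n.
by apply/card_gt0P; exists t0.
Qed.

Lemma avg_reindex f (u : T -> T) : injective u -> avg (f \o u) = avg f.
Proof. by move=> uI; rewrite /avg [in RHS](reindex_inj uI). Qed.

Lemma avg_eq0 f : (forall t, 0 <= f t) -> avg f <= 0 -> forall t, f t = 0.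
Proof.
move=> f0 h t; have T0 : (0 : R) < #|T|%:R.
  by rewrite ltr0n; apply/card_gt0P; exists t.
move: h; rewrite /avg pmulr_lle0 ?invr_gt0// => h.
have /eqP : \sum_t f t = 0 by apply/le_anti; rewrite h sumr_ge0.
by rewrite psumr_eq0 // => /allP /(_ t); rewrite mem_index_enum => /(_ isT)/eqP.
Qed.

Lemma avg_mem (A : {set T}) : avg (fun t => (t \in A)%:R) = #|A|%:R / #|T|%:R.
Proof.
by rewrite /avg -natr_sum -[#|A|]sum1_card [in RHS]big_mkcond.
Qed.

(** Cauchy-Schwarz, proved by weighted AM-GM. If [p] or [q] is 0, the corresponding function
    vanishes identically. *)
Lemma avg_normM_le f g (M p q : R) : 0 <= p -> 0 <= q ->
  avg (fun t => f t ^+ 2) <= M * p ^+ 2 ->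
  avg (fun t => g t ^+ 2) <= M * q ^+ 2 ->
  avg (fun t => `|f t| * `|g t|) <= M * p * q.
Proof.
have degen (u w : T -> R) : avg (fun t => u t ^+ 2) <= M * 0 ^+ 2 ->
    avg (fun t => `|u t| * `|w t|) <= 0.
  rewrite expr0n mulr0 => u0; rewrite (@eq_avg _ (fun t => 0 * `|w t|)).
    by rewrite avgZl mul0r.
  move=> t; have /eqP := avg_eq0 (fun t => sqr_ge0 (u t)) u0 t.
  by rewrite sqrf_eq0 => /eqP ->; rewrite normr0.
rewrite le_eqVlt => /predU1P[<-|p0].
  by move=> _ /degen fg _; rewrite mulr0 mul0r; apply: fg.
rewrite le_eqVlt => /predU1P[<-|q0].
  move=> _ /degen gf; rewrite mulr0 (@eq_avg _ (fun t => `|g t| * `|f t|)).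
    exact: gf.
  by move=> t; rewrite mulrC.
move=> fM gM.
(* These weights make each half contribute at most [M * p * q / 2]. *)
pose w t := (q / p / 2) * f t ^+ 2 + (p / q / 2) * g t ^+ 2.
apply: (@le_trans _ _ (avg w)).
  apply: ler_avg => t; rewrite /w -(real_normK (num_real (f t))).
  rewrite -(real_normK (num_real (g t))); move: `|f t| `|g t| => x y.
  rewrite -subr_ge0.
  have -> : q / p / 2 * x ^+ 2 + p / q / 2 * y ^+ 2 - x * y =
            (q * x - p * y) ^+ 2 / (2 * p * q).
    by field; rewrite !lt0r_neq0.
  by rewrite divr_ge0 ?sqr_ge0// !mulr_ge0// ltW.
rewrite avgD !avgZl.
have -> : M * p * q = q / p / 2 * (M * p ^+ 2) + p / q / 2 * (M * q ^+ 2).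
  by field; rewrite !lt0r_neq0.
by rewrite lerD// ler_wpM2l// divr_ge0// divr_ge0// ltW.
Qed.

End Basics.

Lemma exchange_avg (T U : finType) (f : T -> U -> R) :
  avg (fun t => avg (f t)) = avg (fun u => avg (f^~ u)).
Proof. by rewrite /avg -!mulr_suml exchange_big /= mulrAC. Qed.

(** The values of a uniformly random function are independent. *)
Lemma avg_prod (I J : finType) (F : I -> J -> R) :
  avg (fun f : {ffun I -> J} => \prod_i F i (f i)) = \prod_i avg (F i).
Proof.
rewrite /avg big_split /= bigA_distr_bigA /= card_ffun prodr_const.
by rewrite natrX exprVn.
Qed.

End Average.

(** * Taylor and product inequalities *)

Section RealInequalities.
Context {R : realType}.

(** Multiplying the bound for m by p creates one new quadratic term, with coefficient at most m,
    which the growth from m^2 to (m+1)^2 absorbs. *)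
Lemma exprn_le_taylor2 (m : nat) (p a : R) : 0 <= p <= 1 -> 0 <= a <= 1 ->
  p ^+ m <= a ^+ m + m%:R * a ^+ m.-1 * (p - a) + m%:R ^+ 2 * (p - a) ^+ 2.
Proof.
move=> /andP[p0 p1] /andP[a0 a1]; elim: m => [|m IH].
  by rewrite !expr0 !(mul0r, expr0n)/= !addr0.
have d0 := sqr_ge0 (p - a).
case: m IH => [_|m IH]; first by rewrite !expr1 expr0 expr1n; lra.
rewrite /= in IH *.
set q := m.+1%:R in IH *; have -> : m.+2%:R = q + 1 :> R by rewrite /q natr1.
have q0 : 0 <= q by rewrite /q.
set A := a ^+ m in IH; have A1 : A <= 1 by rewrite exprn_ile1.
have A0 : 0 <= A by rewrite exprn_ge0.
rewrite !exprS -/A in IH *; set P := p ^+ m in IH *.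
have := ler_wpM2l p0 IH.
set d := p - a in d0 *; have -> : p = a + d by rewrite /d; ring.
have p1' : a + d <= 1 by rewrite /d; lra.
have h1 : (a + d) * (q ^+ 2 * d ^+ 2) <= q ^+ 2 * d ^+ 2.
  by rewrite ler_piMl// mulr_ge0// sqr_ge0.
have h2 : q * A * d ^+ 2 <= q * d ^+ 2.
  by rewrite -mulrA ler_wpM2l// ler_piMl.
have h3 : 0 <= q * d ^+ 2 by rewrite mulr_ge0.
lra.
Qed.

Lemma norm_prodB_le (I : Type) (r : seq I) (a b : I -> R) :
  (forall i, 0 <= a i <= 1) -> (forall i, 0 <= b i <= 1) ->
  `|\prod_(i <- r) a i - \prod_(i <- r) b i| <= \sum_(i <- r) `|a i - b i|.
Proof.
move=> ha hb; elim: r => [|i r IH]; first by rewrite !big_nil subrr normr0.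
rewrite !big_cons.
set A := \prod_(j <- r) a j in IH *; set B := \prod_(j <- r) b j in IH *.
have -> : a i * A - b i * B = a i * (A - B) + (a i - b i) * B by ring.
have /andP[a0 a1] := ha i.
have B0 : 0 <= B by apply: prodr_ge0 => j _; case/andP: (hb j).
have B1 : B <= 1 by apply: prodr_ile1 => j _; apply: hb.
rewrite (le_trans (ler_normD _ _))// addrC lerD//.
  by rewrite normrM (ger0_norm B0) ler_piMr.
by rewrite normrM (ger0_norm a0) (le_trans _ IH)// ler_piMl.
Qed.

(* The first-order terms of the product only see the bias of the factors, and
   the second-order ones only their mean square deviations. *)
Lemma avg_prod_bias (T : finType) (I : Type) (r : seq I) (t0 : T)
    (a : I -> T -> R) (b g : I -> R) (K M : R) :
  0 <= K -> 0 <= M -> (forall i, 0 <= g i) ->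
  (forall i t, 0 <= a i t <= 1) -> (forall i, 0 <= b i <= 1) ->
  (forall i, `|avg (a i) - b i| <= K * g i ^+ 2) ->
  (forall i, avg (fun t => (a i t - b i) ^+ 2) <= M * g i ^+ 2) ->
  `|avg (fun t => \prod_(i <- r) a i t) - \prod_(i <- r) b i|
    <= (K + M) * (\sum_(i <- r) g i) ^+ 2.
Proof.
move=> K0 M0 g0 ha hb hK hM; elim: r => [|i r IH].
  rewrite !big_nil (@eq_avg _ _ _ (fun=> 1)) => [|t]; last by rewrite big_nil.
  by rewrite (avg_cst t0) subrr normr0 expr0n mulr0.
rewrite !big_cons; set B := \prod_(j <- r) b j in IH *.
set G := \sum_(j <- r) g j in IH *.
have G0 : 0 <= G by apply: sumr_ge0.
pose A t := \prod_(j <- r) a j t.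
have -> : avg (fun t => \prod_(j <- i :: r) a j t) - b i * B =
   b i * (avg A - B) + (avg (a i) - b i) * B
     + avg (fun t => (a i t - b i) * (A t - B)).
  rewrite (@eq_avg _ _ _ (fun t => ((a i t - b i) * (A t - B) + b i * A t)
     + (a i t * B - b i * B))) => [|t]; last by rewrite big_cons /A; ring.
  rewrite !(avgD, avgN, avgZl, avgZr) (avg_cst t0); ring.
have /andP[b0 b1] := hb i.
have B0 : 0 <= B by apply: prodr_ge0 => j _; case/andP: (hb j).
have B1 : B <= 1 by apply: prodr_ile1 => j _; apply: hb.
have h1 : `|b i * (avg A - B)| <= (K + M) * G ^+ 2.
  by rewrite normrM (ger0_norm b0) (le_trans _ IH)// ler_piMl.
have h2 : `|(avg (a i) - b i) * B| <= K * g i ^+ 2.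
  by rewrite normrM (ger0_norm B0) (le_trans _ (hK i))// ler_piMr.
(* [A t - B] is telescoped into the deviations of the remaining factors, and Cauchy-Schwarz is
   applied pair by pair. *)
have h3 : `|avg (fun t => (a i t - b i) * (A t - B))| <= M * g i * G.
  rewrite (le_trans (ler_norm_avg _))// /G mulr_sumr.
  apply: (@le_trans _ _ (avg (fun t =>
     \sum_(j <- r) `|a i t - b i| * `|a j t - b j|))).
    apply: ler_avg => t; rewrite normrM -mulr_sumr ler_wpM2l//.
    exact: norm_prodB_le.
  rewrite avg_sum; apply: ler_sum => j _.
  exact: avg_normM_le.
have h4 : 0 <= K * (g i * G) by rewrite !mulr_ge0.
have h5 : 0 <= M * (g i * G) by rewrite !mulr_ge0.
have h6 : 0 <= M * g i ^+ 2 by rewrite mulr_ge0 ?sqr_ge0.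
rewrite (le_trans (ler_normD _ _))//.
have := lerD (le_trans (ler_normD _ _) (lerD h1 h2)) h3.
move=> /le_trans; apply.
rewrite -subr_ge0.
have -> : (K + M) * (g i + G) ^+ 2 -
  ((K + M) * G ^+ 2 + K * g i ^+ 2 + M * g i * G) =
  2 * (K * (g i * G)) + M * (g i * G) + M * g i ^+ 2 by ring.
lra.
Qed.

End RealInequalities.

(** * Fraction of bins missed by the hash values *)

Section FreeFraction.
Context {R : realType} {V : finZmodType} {K : finType}.
Implicit Types (X : {set K}) (D : {set V}) (f : K -> V).

Let n : R := #|V|%:R.

Lemma card_zmod_gt0 : 0 < #|V|%:R :> R.
Proof. by rewrite ltr0n; apply/card_gt0P; exists 0. Qed.

Lemma avg_shift (F : V -> R) (u : V) : avg (fun v => F (u + v)) = avg F.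
Proof. exact: (avg_reindex _ (addrI u)). Qed.

Definition translate D (e : V) : {set V} := [set d + e | d in D].

Lemma mem_translate D e v : (v \in translate D e) = (v - e \in D).
Proof.
apply/imsetP/idP => [[d dD ->]|vD]; first by rewrite addrK.
by exists (v - e); rewrite ?subrK.
Qed.

Lemma card_translate D e : #|translate D e| = #|D|.
Proof. by rewrite card_imset//; apply: addIr. Qed.

Definition avoids X D f (y : V) : bool := [forall x in X, f x - y \notin D].

(** Empty bins correspond to [D = [set 0]]; general [D] keep the family closed under squaring. *)
Definition free_frac X D f : R := avg (fun y => (avoids X D f y)%:R).

Lemma free_frac_itv X D f : 0 <= free_frac X D f <= 1.
Proof.
rewrite avg_ge0//= -[leRHS](avg_cst (0 : V)); apply: ler_avg => y.
by rewrite lern1 leq_b1.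
Qed.

(** The square is the probability that two independent bins y and y + e both avoid; this says that y
    avoids [D] and [D + e] together. *)
Lemma free_frac_sqr X D f :
  free_frac X D f ^+ 2 =
  avg (fun e => free_frac X (D :|: translate D e) f).
Proof.
rewrite expr2 -avgZr exchange_avg; apply: eq_avg => y.
rewrite -avgZl -(avg_shift _ y); apply: eq_avg => e; rewrite -natrM mulnb.
congr (_%:R); congr nat_of_bool.
apply/andP/forall_inP => [[/forall_inP h1 /forall_inP h2] x xX|h].
  rewrite finset.in_setU mem_translate negb_or h1//= -addrA -opprD.
  exact: h2.
split; apply/forall_inP => x /h; rewrite finset.in_setU mem_translate negb_or.
  by case/andP.
by rewrite -addrA -opprD => /andP[].
Qed.

(** Double counting: each pair (v, d) of [E] x [D] is matched by the single shift e = v - d. *)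
Lemma sum_card_overlap D E :
  \sum_(e : V) #|E :&: translate D e|%:R = #|E|%:R * #|D|%:R :> R.
Proof.
rewrite -natr_sum -natrM; congr (_%:R).
under eq_bigr do rewrite -sum1_card big_mkcond /=.
rewrite exchange_big /= (bigID (mem E)) /= [X in (_ + X)%N]big1 ?addn0; last first.
  by move=> v vE; rewrite big1// => e _; rewrite inE (negbTE vE).
rewrite -[X in (X * _)%N]sum1_card big_distrl /=.
apply: eq_bigr => v vE; rewrite mul1n -big_mkcond sum1dep_card.
rewrite -(@card_imset _ _ (fun e => v - e)); last first.
  by move=> e1 e2 /addrI/oppr_inj.
congr #|pred_of_set _|; apply/setP => w; apply/imsetP/idP => [[e]|wD].
  by rewrite !inE vE mem_translate /= => eD ->.
by exists (v - w); rewrite ?inE ?mem_translate ?vE opprB addrC subrK.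
Qed.

(* The factors on the left have average exactly (1 - |D|/n)^2, so that only the
   second-order Taylor term contributes. *)
Lemma avg_overlap_le D (m : nat) :
  avg (fun e : V => (1 - #|D :|: translate D e|%:R / n) ^+ m)
  <= ((1 - #|D|%:R / n) ^+ m) ^+ 2 + (#|D| ^ 3)%:R * (m%:R ^+ 2 / n ^+ 3).
Proof.
have n0 : 0 < n := card_zmod_gt0; have nn0 := lt0r_neq0 n0.
have card01 (E : {set V}) : 0 <= 1 - #|E|%:R / n <= 1.
  rewrite subr_ge0 ler_pdivrMr// mul1r ler_nat max_card/=.
  by rewrite gerBl divr_ge0// ltW.
pose o e : R := #|D :&: translate D e|%:R.
set d : R := #|D|%:R; set a := (1 - d / n) ^+ 2.
have pE e : 1 - #|D :|: translate D e|%:R / n = a + (o e - d ^+ 2 / n) / n.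
  have -> : #|D :|: translate D e|%:R = d + d - o e.
    by rewrite /o /d -natrD -{2}(card_translate D e) -cardsUI natrD addrK.
  by rewrite /a; field.
have avgo : avg o = d ^+ 2 / n by rewrite /avg sum_card_overlap expr2.
(* One factor [o e] is bounded by [d], the other is averaged exactly. *)
have avgo2 : avg (fun e => o e ^+ 2) <= d ^+ 3 / n.
  rewrite exprS -mulrA -avgo -avgZl; apply: ler_avg => e.
  by rewrite expr2 ler_wpM2r// ler_nat subset_leq_card// subsetIl.
have a01 : 0 <= a <= 1.
  by have /andP[? ?] := card01 D; rewrite sqr_ge0 exprn_ile1.
apply: (@le_trans _ _ (avg (fun e => a ^+ m
   + m%:R * a ^+ m.-1 * ((o e - d ^+ 2 / n) / n)
   + m%:R ^+ 2 * ((o e - d ^+ 2 / n) / n) ^+ 2))).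
  apply: ler_avg => e; have := exprn_le_taylor2 m (card01 (D :|: translate D e)) a01.
  by rewrite pE; set x := (_ / n); have -> : a + x - a = x by ring.
rewrite !avgD (avg_cst (0 : V)) !avgZl avgZr avgB avgo (avg_cst (0 : V)).
rewrite subrr mul0r mulr0 addr0 -exprM mulnC exprM lerD2l.
rewrite [leRHS]mulrCA ler_wpM2l ?sqr_ge0//.
rewrite (@eq_avg _ _ _ (fun e => (o e ^+ 2 - 2 * (d ^+ 2 / n) * o e
  + (d ^+ 2 / n) ^+ 2) * n ^- 2)) => [|e]; last by field.
rewrite avgZr avgD avgB avgZl (avg_cst (0 : V)) avgo natrX -/d.
have -> : d ^+ 3 / n ^+ 3 = d ^+ 3 / n * n ^- 2 by field.
rewrite ler_wpM2r ?invr_ge0 ?exprn_ge0 ?(ltW n0)//.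
have := sqr_ge0 (d ^+ 2 / n); lra.
Qed.

End FreeFraction.

(** * From bias to mean square deviation *)

Section MeanSquare.
Context {R : realType} {V : finZmodType}.

(** Expand the square. The mean of F^2 costs [k2] (bias for the enlarged sets) plus [#|D| ^ 3]
    (overlaps), and the cross term -2 rho F costs [2 * k1]. *)
Lemma free_frac_msq (T K : finType) (t0 : T) (f : T -> K -> V)
    (X : {set K}) (D : {set V}) (k1 k2 : R) :
  let dev E (t : T) := free_frac X E (f t) - (1 - #|E|%:R / #|V|%:R) ^+ #|X| in
  let kappa : R := #|X|%:R ^+ 2 / #|V|%:R ^+ 3 in
  `|avg (dev D)| <= k1 * kappa ->
  (forall E : {set V}, (#|E| <= #|D|.*2)%N -> `|avg (dev E)| <= k2 * kappa) ->
  avg (fun t => dev D t ^+ 2) <= (k2 + (#|D| ^ 3)%:R + 2 * k1) * kappa.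
Proof.
set rho := fun E : {set V} => (1 - #|E|%:R / #|V|%:R) ^+ #|X| : R.
rewrite /= => h1 h2; set kappa := (_ ^+ 2 / _) in h1 h2 *.
have k0 : 0 <= kappa by rewrite divr_ge0 ?sqr_ge0// exprn_ge0// ltW// card_zmod_gt0.
have /andP[r0 r1] : 0 <= rho D <= 1.
  have n0 : (0 : R) < #|V|%:R := card_zmod_gt0.
  have b0 : 0 <= 1 - #|D|%:R / #|V|%:R :> R.
    by rewrite subr_ge0 ler_pdivrMr// mul1r ler_nat max_card.
  by rewrite exprn_ge0// exprn_ile1// gerBl divr_ge0// ltW.
pose F E t : R := free_frac X E (f t).
have bias E : avg (fun t => F E t - rho E) = avg (F E) - rho E.
  by rewrite avgB (avg_cst t0).
rewrite (@eq_avg _ _ _ (fun t => F D t ^+ 2 - (2 * rho D) * F D t + rho D ^+ 2)).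
  2: by move=> t; rewrite /F -/(rho D); ring.
rewrite avgD avgB avgZl (avg_cst t0).
have sq : avg (fun t => F D t ^+ 2) <=
    rho D ^+ 2 + (#|D| ^ 3)%:R * kappa + k2 * kappa.
  under eq_avg do rewrite /F free_frac_sqr.
  rewrite exchange_avg.
  apply: (@le_trans _ _ (avg (fun e : V => rho (D :|: translate D e) + k2 * kappa))).
    apply: ler_avg => e; set E := _ :|: _.
    have DE : (#|E| <= #|D|.*2)%N.
      rewrite -addnn -[X in (_ <= _ + X)%N](card_translate D e).
      by rewrite -cardsUI leq_addr.
    have : `|avg (fun t => F E t - rho E)| <= k2 * kappa := h2 E DE.
    by rewrite bias ler_norml => /andP[_]; rewrite lerBlDl.
  by rewrite avgD (avg_cst (0 : V)) lerD2r; apply: avg_overlap_le.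
have low : rho D - k1 * kappa <= avg (F D).
  have : `|avg (fun t => F D t - rho D)| <= k1 * kappa := h1.
  by rewrite bias ler_norml => /andP[+ _]; lra.
have := ler_wpM2l r0 low.
have := ler_piMl (le_trans (normr_ge0 _) h1) r1; lra.
Qed.

End MeanSquare.

(** * Bias of the free fraction, by induction on positions *)

Section Tabulation.
Context {R : realType} {V : finZmodType} {c s : nat}.

Notation tab := {ffun 'I_c -> {ffun 'I_s -> V}}.
Implicit Types (X : {set key c s}) (D : {set V}) (h : tab).

(** Resampling principle: a translation preserves the uniform distribution on tables, so an extra
    random shift may be inserted. *)
Lemma avg_shifts (W : finType) (w0 : W) (u : W -> tab) (F : tab -> R) :
  avg F = avg (fun h => avg (fun w => F (h + u w))).
Proof.
rewrite exchange_avg -[LHS](avg_cst w0); apply: eq_avg => w.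
by rewrite -(avg_reindex F (addIr (u w))).
Qed.

Definition prefix_hash (k : nat) (h : tab) (x : key c s) : V :=
  \sum_(i < c | (i < k)%N) h i (x i).

Lemma prefix_hashS (k : 'I_c) h x :
  prefix_hash k.+1 h x = prefix_hash k h x + h k (x k).
Proof.
rewrite /prefix_hash (bigD1 k)//= addrC; congr (_ + _); apply: eq_bigl => i.
by rewrite ltnS ltn_neqAle andbC.
Qed.

Definition only_table (k : 'I_c) (v : {ffun 'I_s -> V}) : tab :=
  [ffun i => if i == k then v else 0].

Lemma prefix_hash_only (k : 'I_c) v h x :
  prefix_hash k (h + only_table k v) x = prefix_hash k h x.
Proof.
apply: eq_bigr => i ik; rewrite !ffunE; case: eqP => [ik'|_].
  by rewrite ik' ltnn in ik.
by rewrite ffunE addr0.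
Qed.

Definition slice X (k : 'I_c) (a : 'I_s) : {set key c s} :=
  [set x in X | x k == a].

Lemma sum_card_slice X (k : 'I_c) : (\sum_a #|slice X k a|)%N = #|X|.
Proof.
rewrite -sum1_card (partition_big (fun x : key c s => x k) predT)//=.
apply: eq_bigr => a _; rewrite -sum1_card; apply: eq_bigl => x.
by rewrite inE.
Qed.

(** For a fixed bin y, resample table [k]. Avoiding y splits into one condition per character a,
    involving only the entry at a; these entries are independent, and each shifts y to a uniform
    bin. *)
Lemma avg_free_fracS X D (k : 'I_c) :
  avg (fun h : tab => free_frac X D (prefix_hash k.+1 h)) =
  avg (fun h : tab => \prod_a free_frac (slice X k a) D (prefix_hash k h)) :> R.
Proof.
rewrite exchange_avg -[RHS](avg_cst (0 : V)); apply: eq_avg => y.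
rewrite (avg_shifts (0 : {ffun 'I_s -> V}) (only_table k)); apply: eq_avg => h.
pose I a w : R := (avoids (slice X k a) D (prefix_hash k h) (y - h k a - w))%:R.
rewrite (@eq_avg _ _ _ (fun v : {ffun 'I_s -> V} => \prod_a I a (v a))).
  rewrite avg_prod; apply: eq_bigr => a _.
  have inj : injective (fun w => y - h k a - w) by move=> w1 w2 /addrI/oppr_inj.
  by rewrite /free_frac -[RHS](avg_reindex _ inj).
move=> v; rewrite /I -natr_prod; congr (_%:R).
have hx x : prefix_hash k.+1 (h + only_table k v) x - y =
    prefix_hash k h x - (y - h k (x k) - v (x k)).
  rewrite prefix_hashS prefix_hash_only !ffunE eqxx.
  have alg (p a b z : V) : p + (a + b) - z = p - (z - a - b).
    by rewrite -addrA !opprB; congr (_ + _); rewrite addrA [b + a]addrC.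
  exact: alg.
apply/esym/eqP; case: (boolP (avoids _ _ _ y)) => [/forall_inP av|].
  rewrite big1// => a _; apply/eqP; rewrite eqb1; apply/forall_inP => x.
  by rewrite inE => /andP[xX /eqP <-]; rewrite -hx; apply: av.
rewrite negb_forall_in => /exists_inP[x xX]; rewrite negbK hx => xD.
rewrite (bigD1 (x k))//= -[X in (X * _)%N]/(nat_of_bool _) muln_eq0 eqb0.
apply/orP; left; rewrite negb_forall_in; apply/exists_inP; exists x.
  by rewrite inE xX eqxx.
by rewrite negbK.
Qed.

(** Bias constant plus mean square constant for one position fewer, the latter as in
    [free_frac_msq]; [d.*2] appears because squaring may double the size of [D]. *)
Fixpoint bias_const (k d : nat) : nat :=
  if k is k'.+1 then
    (bias_const k' d + (bias_const k' d.*2 + d ^ 3 + 2 * bias_const k' d))%N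
  else 0.

(** Induction invariant: slicing at position k lowers k+1 to k, and for k = 0 at most one key is
    left. *)
Definition determined_by_prefix (k : nat) X :=
  {in X &, forall x y : key c s, (forall i : 'I_c, (i < k)%N -> x i = y i) -> x = y}.

Lemma free_frac_bias (k d : nat) X D : (k <= c)%N -> (#|D| <= d)%N ->
  determined_by_prefix k X ->
  `|avg (fun h : tab => free_frac X D (prefix_hash k h)
       - (1 - #|D|%:R / #|V|%:R) ^+ #|X|)|
    <= (bias_const k d)%:R * (#|X|%:R ^+ 2 / #|V|%:R ^+ 3) :> R.
Proof.
have n0 : (0 : R) < #|V|%:R := card_zmod_gt0.
elim: k d X D => [|k IH] d X D kc Dd inj.
  (* With no positions all hash values are 0 and [X] has at most one key, so the free fraction is
     exactly its ideal value. *)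
  rewrite mul0r (@eq_avg _ _ _ (fun=> 0)) ?(avg_cst (0 : tab)) ?normr0// => h.
  have -> : free_frac X D (prefix_hash 0 h) =
      avg (fun y : V => (avoids X D (fun=> 0) y)%:R) :> R.
    apply: eq_avg => y; congr (_%:R); congr nat_of_bool.
    by apply: eq_forallb => x; rewrite /prefix_hash big_pred0.
  have [->|[x xX]] := set_0Vmem X.
    rewrite cards0 expr0 (@eq_avg _ _ _ (fun=> 1)) ?(avg_cst (0 : V)) ?subrr//.
    by move=> y; rewrite (_ : avoids _ _ _ _)//; apply/forall_inP => x; rewrite inE.
  have -> : X = [set x].
    apply/setP => y; rewrite inE; apply/idP/eqP => [yX|->//].
    by apply: inj.
  rewrite cards1 expr1 (@eq_avg _ _ _ (fun y => 1 - (- y \in D)%:R)).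
    rewrite avgB (avg_cst (0 : V)).
    have /= -> := @avg_reindex R _ (fun y => (y \in D)%:R) _ (@oppr_inj V).
    by rewrite avg_mem subrr.
  move=> y; rewrite (_ : avoids _ _ _ _ = (- y \notin D)).
    by case: (_ \in D); rewrite ?subrr ?subr0.
  apply/forall_inP/idP => [/(_ x)|yD z _]; last by rewrite sub0r.
  by rewrite inE eqxx sub0r; apply.
pose k' : 'I_c := Ordinal kc.
have injs a : determined_by_prefix k (slice X k' a).
  move=> x y; rewrite !inE => /andP[xX /eqP xa] /andP[yX /eqP ya] xy.
  apply: inj => // i; rewrite ltnS leq_eqVlt => /predU1P[ik|/xy//].
  by have -> : i = k'; [apply/val_inj|rewrite xa ya].
rewrite avgB (avg_cst (0 : tab)) (avg_free_fracS X D k') /=.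
have -> : (1 - #|D|%:R / #|V|%:R) ^+ #|X| =
    \prod_a (1 - #|D|%:R / #|V|%:R) ^+ #|slice X k' a| :> R.
  by rewrite -(sum_card_slice X k') expr_sum.
pose B : R := (bias_const k d)%:R.
pose M : R := (bias_const k d.*2 + d ^ 3 + 2 * bias_const k d)%:R.
(* [avg_prod_bias] is used with the slice sizes as weights; they sum to [#|X|]. *)
have -> : ((bias_const k d + (bias_const k d.*2 + d ^ 3 + 2 * bias_const k d))%N)%:R
   * (#|X|%:R ^+ 2 / #|V|%:R ^+ 3) =
   (B / #|V|%:R ^+ 3 + M / #|V|%:R ^+ 3) * (\sum_a #|slice X k' a|%:R) ^+ 2.
  by rewrite -natr_sum sum_card_slice natrD -/B -/M; ring.
have b01 : 0 <= (1 : R) - #|D|%:R / #|V|%:R <= 1.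
  rewrite subr_ge0 ler_pdivrMr// mul1r ler_nat max_card/=.
  by rewrite gerBl divr_ge0// ltW.
have n3 : (0 : R) <= #|V|%:R ^+ 3 by rewrite exprn_ge0// ltW.
apply: avg_prod_bias => //.
- exact: (0 : tab).
- by rewrite divr_ge0.
- by rewrite divr_ge0.
- by move=> a h; apply: free_frac_itv.
- by move=> a; case/andP: b01 => *; rewrite exprn_ge0// exprn_ile1.
- move=> a; rewrite mulrAC -mulrA; have := IH d _ D (ltnW kc) Dd (injs a).
  by rewrite avgB (avg_cst (0 : tab)).
- move=> a; rewrite mulrAC -mulrA.
  have b1 := IH d _ D (ltnW kc) Dd (injs a).
  have Dd2 : (#|D|.*2 <= d.*2)%N by rewrite leq_double.
  have b2 := fun (E : {set V}) (ED : (#|E| <= #|D|.*2)%N) =>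
    IH d.*2 _ E (ltnW kc) (leq_trans ED Dd2) (injs a).
  have := free_frac_msq (0 : tab) b1 b2.
  move=> /le_trans; apply; apply: ler_wpM2r.
    by rewrite divr_ge0// sqr_ge0.
  by rewrite /M -natrM -!natrD ler_nat leq_add2r leq_add2l leq_exp2r.
Qed.

End Tabulation.

(** * Occupied bins: second moment and resampling of one table entry *)

Section ImageSize.
Context {R : realType} {V : finZmodType} {c s : nat}.

Notation tab := {ffun 'I_c -> {ffun 'I_s -> V}}.
Notation n := (#|V|%:R : R).
Implicit Types (X : {set key c s}) (h : tab).

Definition hash h (x : key c s) : V := \sum_i h i (x i).

Lemma hash_addD h1 h2 x : hash (h1 + h2) x = hash h1 x + hash h2 x.
Proof. by rewrite /hash -big_split; apply: eq_bigr => i _; rewrite !ffunE. Qed.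

Lemma hash_only_table (p : 'I_c) v x : hash (only_table p v) x = v (x p).
Proof.
rewrite /hash (bigD1 p)//= big1 => [|i /negbTE ip]; rewrite !ffunE ?ip ?ffunE//.
by rewrite eqxx addr0.
Qed.

Definition occupied h X : {set V} := hash h @: X.

Definition mean_random (m : nat) : R := n * (1 - (1 - n^-1) ^+ m).

Lemma card_occupied h X : #|occupied h X|%:R = n * (1 - free_frac X [set 0] (hash h)).
Proof.
have n0 : (0 : R) < n := card_zmod_gt0.
have -> : free_frac X [set 0] (hash h) = 1 - #|occupied h X|%:R / n.
  rewrite -avg_mem -[X in X - _](avg_cst (0 : V)) -avgB; apply: eq_avg => y.
  case: (boolP (y \in occupied h X)) => [/imsetP[x xX ->]|yN].
    rewrite subrr (_ : avoids _ _ _ _ = false)//; apply/negbTE.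
    rewrite negb_forall_in; apply/exists_inP; exists x => //.
    by rewrite subrr negbK inE.
  rewrite subr0 (_ : avoids _ _ _ _)//; apply/forall_inP => x xX.
  rewrite inE subr_eq0; apply: contraNneq yN => <-.
  exact: imset_f.
by field; rewrite lt0r_neq0.
Qed.

Lemma card_occupied_msq X :
  avg (fun h => (#|occupied h X|%:R - mean_random #|X|) ^+ 2)
  <= (bias_const c 2 + 1 + 2 * bias_const c 1)%:R * (#|X|%:R ^+ 2 / n).
Proof.
have n0 : (0 : R) < n := card_zmod_gt0.
have hashE h : prefix_hash c h =1 hash h.
  by move=> x; apply: eq_bigl => i; rewrite ltn_ord.
have inj : determined_by_prefix c X.
  by move=> x y _ _ xy; apply/ffunP => i; apply: xy.
have := @free_frac_msq R V _ _ (0 : tab) (prefix_hash c) X [set 0] _ _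
  (free_frac_bias (leqnn c) (leqnn _) inj)
  (fun E ED => free_frac_bias (leqnn c) ED inj).
rewrite cards1 exp1n mul1r -natrM -!natrD => msq.
rewrite (@eq_avg _ _ _ (fun h => n ^+ 2 *
   (free_frac X [set 0] (prefix_hash c h) - (1 - n^-1) ^+ #|X|) ^+ 2)).
  rewrite avgZl (le_trans (ler_wpM2l (sqr_ge0 _) msq))// le_eqVlt; apply/orP; left.
  by apply/eqP; field; rewrite lt0r_neq0.
move=> h; rewrite card_occupied /mean_random.
have -> : free_frac X [set 0] (hash h) = free_frac X [set 0] (prefix_hash c h) :> R.
  apply: eq_avg => y; congr (_%:R); congr nat_of_bool.
  by apply: eq_forallb => x; rewrite hashE.
by move: (free_frac _ _ _) (_ ^+ #|X|) => u w; ring.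
Qed.

(** Since exp(x) >= 1 + x and (1 + x)(1 - x + x^2) = 1 + x^3 >= 1. *)
Lemma expRN_le_quad (x : R) : 0 <= x -> expR (- x) <= 1 - x + x ^+ 2.
Proof.
move=> x0; have x1 : 0 < 1 + x by lra.
rewrite expRN; apply: (@le_trans _ _ (1 + x)^-1).
  by rewrite lef_pV2 ?posrE ?expR_gt0// expR_ge1Dx.
rewrite -div1r ler_pdivrMr//.
have := mulr_ge0 x0 (sqr_ge0 x); lra.
Qed.

(** The union has size |T| + |C| - W with overlap W of mean |T||C|/n. As W <= |C|, also E W^2 <= |C|
    E W, and [expRN_le_quad] applies to l W. *)
Lemma mgf_card_union (T C : {set V}) (l : R) : 0 <= l ->
  avg (fun v => expR (l * #|T :|: translate C v|%:R))
  <= expR (l * (#|T|%:R + #|C|%:R * (1 - #|T|%:R / n))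
           + l ^+ 2 * (#|C|%:R ^+ 2 * #|T|%:R / n)).
Proof.
move=> l0; have n0 : (0 : R) < n := card_zmod_gt0.
pose W v : R := #|T :&: translate C v|%:R.
have avgW : avg W = #|T|%:R * #|C|%:R / n by rewrite /avg sum_card_overlap.
have avgW2 : avg (fun v => W v ^+ 2) <= #|C|%:R * avg W.
  rewrite -avgZl; apply: ler_avg => v; rewrite expr2 ler_wpM2r// ler_nat.
  by rewrite -(card_translate C v) subset_leq_card// subsetIr.
rewrite (@eq_avg _ _ _ (fun v => expR (l * (#|T|%:R + #|C|%:R)) * expR (- (l * W v)))).
  2: move=> v; rewrite -expRD -(card_translate C v) -natrD -cardsUI natrD -/(W v).
  2: by congr expR; ring.
rewrite avgZl.
have -> : l * (#|T|%:R + #|C|%:R * (1 - #|T|%:R / n))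
    + l ^+ 2 * (#|C|%:R ^+ 2 * #|T|%:R / n) =
    l * (#|T|%:R + #|C|%:R) + (- l * avg W + l ^+ 2 * (#|C|%:R * avg W)).
  by rewrite avgW; field; rewrite lt0r_neq0.
rewrite expRD ler_pM2l ?expR_gt0//.
apply: (@le_trans _ _ (avg (fun v => 1 - l * W v + l ^+ 2 * W v ^+ 2))).
  by apply: ler_avg => v; rewrite -exprMn expRN_le_quad// mulr_ge0.
rewrite avgD avgB (avg_cst (0 : V)) !avgZl.
apply: le_trans (expR_ge1Dx _).
have := ler_wpM2l (sqr_ge0 l) avgW2; lra.
Qed.

Definition only_entry (p : 'I_c) (a : 'I_s) (v : V) : tab :=
  [ffun i => [ffun b => if (i == p) && (b == a) then v else 0]].

Lemma hash_only_entry (p : 'I_c) a v h x :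
  hash (h + only_entry p a v) x = if x p == a then hash h x + v else hash h x.
Proof.
rewrite hash_addD /hash [X in _ + X](bigD1 p)//= [X in _ + (_ + X)]big1.
  by rewrite !ffunE eqxx; case: eqP; rewrite ?addr0.
by move=> i /negbTE ip; rewrite !ffunE ip.
Qed.

Lemma occupied_only_entry X (p : 'I_c) a v h :
  occupied (h + only_entry p a v) X =
  occupied h (X :\: slice X p a) :|: translate (occupied h (slice X p a)) v.
Proof.
have hE := hash_only_entry p a v h.
apply/setP => y; apply/imsetP/setUP => [[x xX ->]|].
2: case=> [/imsetP[x xG ->]|/imsetP[_ /imsetP[x xG ->] ->]].
- rewrite hE; case: eqP => [xa|/eqP/negbTE xa].
    by right; apply/imset_f/imset_f; rewrite inE xX xa eqxx.
  by left; apply/imset_f; rewrite !inE xX xa.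
- move: xG; rewrite !inE => /andP[+ xX]; rewrite xX /= => /negbTE xa.
  by exists x; rewrite // hE xa.
- move: xG; rewrite inE => /andP[xX xa]; exists x => //.
  by rewrite hE xa.
Qed.

(** Resampling the entry at (p, a) translates the values of the slice and fixes the others. The
    resulting exponent is affine in the number T of bins occupied by the other keys: g + (1 - g/n)
    T, whence the damped parameter. *)
Lemma mgf_slice X (p : 'I_c) a (l : R) : 0 <= l ->
  let g : R := #|slice X p a|%:R in
  avg (fun h => expR (l * #|occupied h X|%:R))
  <= expR (l * g + l ^+ 2 * (g ^+ 2 * #|X :\: slice X p a|%:R / n)) *
     avg (fun h => expR (l * (1 - g / n) * #|occupied h (X :\: slice X p a)|%:R)).
Proof.
move=> l0 /=; set g : R := #|slice X p a|%:R; have n0 : (0 : R) < n := card_zmod_gt0.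
rewrite (avg_shifts (0 : V) (only_entry p a)) -avgZl; apply: ler_avg => h.
under eq_avg do rewrite occupied_only_entry.
apply: (le_trans (mgf_card_union _ _ l0)).
rewrite -expRD ler_expR.
set T : R := #|occupied h (X :\: _)|%:R; set C : R := #|occupied h (slice _ _ _)|%:R.
have Cg : C <= g by rewrite ler_nat leq_imset_card.
have Tn : 0 <= 1 - T / n.
  by rewrite subr_ge0 ler_pdivrMr// mul1r ler_nat max_card.
have -> : l * g + l ^+ 2 * (g ^+ 2 * #|X :\: slice X p a|%:R / n)
   + l * (1 - g / n) * T =
   l * (T + g * (1 - T / n)) + l ^+ 2 * (g ^+ 2 * #|X :\: slice X p a|%:R / n).
  by ring.
rewrite lerD// ler_wpM2l ?sqr_ge0//.
  by rewrite lerD2l ler_wpM2r.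
rewrite ler_wpM2r ?invr_ge0 ?(ltW n0)// ler_pM ?sqr_ge0 ?ler_nat ?leq_imset_card//.
by rewrite lerXn2r// nnegrE.
Qed.

(** Take a nonempty slice of minimal size g. Every position then shows at most |X|/g characters, and
    [X] lies in the product of these character sets. *)
Lemma exists_small_slice X : (0 < c)%N -> X != finset.set0 ->
  exists p a, (0 < #|slice X p a|)%N /\ (#|X| * #|slice X p a| ^ c <= #|X| ^ c)%N.
Proof.
move=> c0 /set0Pn[x0 x0X]; pose p0 := Ordinal c0.
pose P (pa : 'I_c * 'I_s) := (0 < #|slice X pa.1 pa.2|)%N.
have slice_gt0 p x : x \in X -> P (p, x p).
  by move=> xX; apply/card_gt0P; exists x; rewrite inE xX eqxx.
case: (@arg_minnP _ (p0, x0 p0) P (fun pa => #|slice X pa.1 pa.2|)).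
  exact: slice_gt0.
move=> [p a] Ppa minpa; exists p, a; split => //.
set g := #|slice X p a|; pose A q : {set 'I_s} := [set x q | x : key c s in X].
have Ag q : (#|A q| * g <= #|X|)%N.
  rewrite -(sum_card_slice X q) (bigID (mem (A q))) /=.
  rewrite (leq_trans _ (leq_addr _ _))// -sum_nat_const; apply: leq_sum => b.
  by case/imsetP => x xX ->; apply: (minpa (q, x q)); apply: slice_gt0.
have XA : (#|X| <= \prod_q #|A q|)%N.
  have -> : (\prod_q #|A q|)%N = #|family (fun q => mem (A q))|.
    by rewrite card_family foldrE big_map big_enum.
  apply/subset_leq_card/fintype.subsetP => x xX; apply/familyP => q.
  exact: (imset_f (fun x : key c s => x q)).
apply: (@leq_trans (\prod_(q < c) (#|A q| * g))).
  by rewrite big_split /= prod_nat_const card_ord leq_mul2r XA orbT.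
have -> : (#|X| ^ c = \prod_(q < c) #|X|)%N by rewrite prod_nat_const card_ord.
by elim/big_ind2: _ => // *; apply: leq_mul.
Qed.

(** Here [m] shrinks as slices are peeled off, while the bound in [M] stays fixed. *)
Lemma small_slice_powR (m g M : nat) : (0 < c)%N -> (0 < m <= M)%N ->
  (m * g ^ c <= m ^ c)%N -> g%:R <= M%:R `^ (1 - c%:R^-1) :> R.
Proof.
move=> c0 /andP[m0 mM] mg.
have gM : (g ^ c <= M ^ c.-1)%N.
  rewrite -(leq_pmul2l m0) (leq_trans mg)// -{1}(prednK c0) expnS leq_mul//.
  by case: (c.-1) => [//|e]; rewrite leq_exp2r.
rewrite -(ler_pXn2r c0) ?nnegrE ?powR_ge0//.
rewrite -[leRHS]powR_mulrn ?powR_ge0// -powRrM mulrBl mul1r mulVf ?pnatr_eq0 -?lt0n//.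
have -> : c%:R - 1 = c.-1%:R :> R by rewrite -{1}(prednK c0) -natr1 addrK.
by rewrite powR_mulrn// -!natrX ler_nat.
Qed.

End ImageSize.

(** * Exponential moment and tail bounds *)

Section Concentration.
Context {R : realType} {V : finZmodType} {c s : nat}.
Hypothesis c_gt0 : (0 < c)%N.

Notation tab := {ffun 'I_c -> {ffun 'I_s -> V}}.
Notation n := (#|V|%:R : R).
Notation mu := (@mean_random R V).
Implicit Types (X : {set key c s}) (h : tab).

(** Equality would hold without the error if (1 - 1/n)^g were 1 - g/n; the second-order Taylor bound
    at 1 limits the difference to g^2/n^2. *)
Lemma mean_randomD_ge (g m : nat) :
  g%:R + (1 - g%:R / n) * mu m <= mu (m + g)%N + g%:R ^+ 2 / n.
Proof.
have n0 : (0 : R) < n := card_zmod_gt0.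
have n1 : 1 <= n by rewrite ler1n; apply/card_gt0P; exists 0.
have p01 : 0 <= 1 - n^-1 <= 1.
  by rewrite subr_ge0 invf_le1// n1 gerBl invr_ge0 ltW.
have := exprn_le_taylor2 g p01 (_ : 0 <= 1 <= 1).
rewrite lexx ler01 => /(_ isT); rewrite !expr1n mulr1.
have -> : 1 - n^-1 - 1 = - n^-1 by ring.
rewrite sqrrN /mean_random exprD; case/andP: p01 => p0 p1.
set a := _ ^+ g; set b := _ ^+ m => ha.
have b0 : 0 <= b by rewrite exprn_ge0.
have b1 : b <= 1 by rewrite exprn_ile1.
have ha' : n * (a - 1 + g%:R / n) <= g%:R ^+ 2 / n.
  have -> : g%:R ^+ 2 / n = n * (g%:R ^+ 2 * n^-1 ^+ 2).
    by field; rewrite lt0r_neq0.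
  by rewrite ler_wpM2l ?(ltW n0)//; lra.
have g2 : 0 <= g%:R ^+ 2 / n by rewrite divr_ge0 ?sqr_ge0// ltW.
have h1 := ler_wpM2l b0 ha'.
have h2 : b * (g%:R ^+ 2 / n) <= g%:R ^+ 2 / n by rewrite ler_piMl.
have -> : g%:R + (1 - g%:R / n) * (n * (1 - b)) =
  n * (1 - b * a) + b * (n * (a - 1 + g%:R / n)).
  by field; rewrite lt0r_neq0.
lra.
Qed.

(** Peel off small slices S one by one. The errors |S|^2/n in the mean are at most g|S|/n, and the
    quadratic ones at most gM|S|/n; both sum linearly in |S|. *)
Lemma mgf_occupied (M : nat) X (l : R) : (#|X| <= M)%N -> (M <= #|V|)%N -> 0 <= l ->
  let g : R := M%:R `^ (1 - c%:R^-1) in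
  avg (fun h => expR (l * #|occupied h X|%:R))
  <= expR (l * (mu #|X| + g * #|X|%:R / n) + l ^+ 2 * (g * M%:R * #|X|%:R / n)).
Proof.
move=> XM Mn + /=; set g : R := _ `^ _.
have n0 : (0 : R) < n := card_zmod_gt0.
have g0 : 0 <= g by apply: powR_ge0.
(* [l] is generalised because each peeling step damps it. *)
have [k] := ubnP #|X|; elim: k X XM l => // k IH X XM l Xk l0.
have [->|X0] := eqVneq X finset.set0.
  rewrite (@eq_avg _ _ _ (fun=> 1)).
    rewrite (avg_cst (0 : tab)) cards0 /mean_random expr0 subrr.
    by rewrite !(mulr0, mul0r, addr0) expR0.
  by move=> h; rewrite /occupied imset0 cards0 mulr0 expR0.
have [p [a [sl0 slX]]] := exists_small_slice c_gt0 X0.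
have X_gt0 : (0 < #|X|)%N by rewrite card_gt0.
have slg : #|slice X p a|%:R <= g.
  by apply: (small_slice_powR c_gt0 _ slX); rewrite X_gt0.
set S := slice X p a in sl0 slX slg; set Y := X :\: S.
have SX : S \subset X by apply/fintype.subsetP => x; rewrite inE => /andP[].
have XYS : #|X| = (#|Y| + #|S|)%N.
  by rewrite addnC -(cardsID S X) (finset.setIidPr SX).
have YM : (#|Y| <= M)%N by rewrite (leq_trans _ XM)// XYS leq_addr.
have Yk : (#|Y| < k)%N.
  by rewrite -ltnS (leq_trans _ Xk)// ltnS XYS -[X in (X < _)%N]addn0 ltn_add2l.
pose q : R := 1 - #|S|%:R / n.
have q0 : 0 <= q.
  rewrite subr_ge0 ler_pdivrMr// mul1r ler_nat (leq_trans _ Mn)//.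
  by rewrite (leq_trans _ XM)// XYS leq_addl.
have q1 : q <= 1 by rewrite gerBl divr_ge0// ltW.
have /= step := @mgf_slice R V c s X p a l l0.
apply: (le_trans step); rewrite -/S -/Y -/q.
have := IH Y YM (l * q) Yk (mulr_ge0 l0 q0).
rewrite -(ler_pM2l (expR_gt0 (l * #|S|%:R + l ^+ 2 * (#|S|%:R ^+ 2 * #|Y|%:R / n)))).
move=> /le_trans; apply; rewrite -expRD ler_expR.
have := mean_randomD_ge #|S| #|Y|; rewrite -XYS -/q.
have -> : #|X|%:R = #|Y|%:R + #|S|%:R :> R by rewrite XYS natrD.
have : #|Y|%:R <= M%:R :> R by rewrite ler_nat.
have : 0 <= #|S|%:R :> R by [].
have : 0 <= #|Y|%:R :> R by [].
have : 0 <= M%:R :> R by [].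
have : 0 < n^-1 by rewrite invr_gt0.
move: slg (mu #|X|) (mu #|Y|); set i := n^-1.
move: #|S|%:R #|Y|%:R (M%:R) => S' Y' M' slg mX mY i0 M0 Y0 S0 YM' hmu.
have h1 : l ^+ 2 * (S' ^+ 2 * Y' * i) <= l ^+ 2 * (g * M' * S' * i).
  rewrite ler_wpM2l ?sqr_ge0// ler_wpM2r ?(ltW i0)// expr2 -mulrA.
  rewrite [g * M' * S']mulrC ler_wpM2l// ler_pM//.
have h2 : (l * q) ^+ 2 * (g * M' * Y' * i) <= l ^+ 2 * (g * M' * Y' * i).
  rewrite ler_wpM2r ?mulr_ge0 ?(ltW i0)// exprMn ler_piMr ?sqr_ge0//.
  by rewrite exprn_ile1.
have h3 : S' + q * (mY + g * Y' * i) <= mX + g * (Y' + S') * i.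
  have h4 : S' ^+ 2 * i <= g * S' * i.
    by rewrite ler_wpM2r ?(ltW i0)// expr2 ler_wpM2r.
  have h5 : q * (g * Y' * i) <= g * Y' * i.
    by rewrite ler_piMl// !mulr_ge0// ltW.
  lra.
have := ler_wpM2l l0 h3; lra.
Qed.

Definition pr (E : pred tab) : R := avg (fun h => (E h)%:R).

Lemma pr_le_avg (E : pred tab) (F : tab -> R) (k : R) : 0 < k ->
  (forall h, 0 <= F h) -> (forall h, E h -> k <= F h) -> pr E <= avg F / k.
Proof.
move=> k0 F0 EF; rewrite -avgZr; apply: ler_avg => h; rewrite ler_pdivlMr//.
by case: (boolP (E h)) => [/EF|_]; rewrite ?mul1r ?mul0r.
Qed.

Lemma pr_le1 (E : pred tab) : pr E <= 1.
Proof.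
rewrite -[leRHS](avg_cst (0 : tab)); apply: ler_avg => h.
by rewrite lern1 leq_b1.
Qed.

Lemma occupied_chebyshev X (K t : R) : 0 < t ->
  avg (fun h => (#|occupied h X|%:R - mu #|X|) ^+ 2) <= K ->
  pr (fun h => #|occupied h X|%:R <= mu #|X| - t) <= K / t ^+ 2.
Proof.
move=> t0 hK.
apply: (@le_trans _ _ (avg (fun h => (#|occupied h X|%:R - mu #|X|) ^+ 2) / t ^+ 2)).
  apply: pr_le_avg => [|h|h hh]; [exact: exprn_gt0|exact: sqr_ge0|].
  by rewrite -[leRHS]sqrrN lerXn2r ?nnegrE//; move: (#|_|%:R) hh => x hh; lra.
by rewrite ler_wpM2r// invr_ge0 exprn_ge0// ltW.
Qed.

Lemma occupied_cantelli X (K t : R) : 0 < t -> 0 < K ->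
  avg (fun h => #|occupied h X|%:R) <= mu #|X| ->
  avg (fun h => (#|occupied h X|%:R - mu #|X|) ^+ 2) <= K ->
  (* Markov for (Z + u)^2, where [u] = K/t minimises (K + u^2)/(t + u)^2; the cross term is harmless
     because E Z <= 0. *)
  pr (fun h => mu #|X| + t <= #|occupied h X|%:R) <= K / (K + t ^+ 2).
Proof.
move=> t0 K0 hmu hK; set u := K / t; have u0 : 0 < u by rewrite divr_gt0.
pose Z h : R := #|occupied h X|%:R - mu #|X|.
have := @pr_le_avg (fun h => mu #|X| + t <= #|occupied h X|%:R)
  (fun h => (Z h + u) ^+ 2) ((t + u) ^+ 2).
move=> /(_ _ _ _)/le_trans; apply.
- by rewrite exprn_gt0// addr_gt0.
- by move=> h; apply: sqr_ge0.
- move=> h; rewrite /Z; move: (#|_|%:R) => x hx.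
  by rewrite lerXn2r ?nnegrE//; lra.
have tK : 0 < K + t ^+ 2 by rewrite addr_gt0// exprn_gt0.
have -> : K / (K + t ^+ 2) = (K + u ^+ 2) / (t + u) ^+ 2.
  rewrite /u; field; rewrite !lt0r_neq0//=.
  by have -> : t * t + K = K + t ^+ 2 by ring.
rewrite ler_wpM2r ?invr_ge0 ?sqr_ge0//.
rewrite (@eq_avg _ _ _ (fun h => Z h ^+ 2 + (2 * u) * Z h + u ^+ 2)).
  2: by move=> h; ring.
rewrite !avgD avgZl (avg_cst (0 : tab)) lerD2r.
have hZ : avg Z <= 0 by rewrite avgB (avg_cst (0 : tab)) subr_le0.
have h : 2 * u * avg Z <= 0 by rewrite mulr_ge0_le0// mulr_ge0// ltW.
by rewrite -[leRHS]addr0 lerD.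
Qed.

Lemma occupied_upper_tail_large X (t : R) : (0 < #|X|)%N -> (#|X| <= #|V|)%N ->
  let g : R := #|X|%:R `^ (1 - c%:R^-1) in
  0 <= t -> 2 * (g * #|X|%:R / n) <= t ->
  pr (fun h => mu #|X| + t <= #|occupied h X|%:R)
  <= expR (- (16^-1 * (t ^+ 2 / (g * #|X|%:R ^+ 2 / n)))).
Proof.
move=> X0 Xn /=; set g : R := _ `^ _ => t0 gt.
have n0 : (0 : R) < n := card_zmod_gt0.
have m0 : 0 < #|X|%:R :> R by rewrite ltr0n.
have g0 : 0 < g by rewrite powR_gt0.
set v : R := g * #|X|%:R ^+ 2 / n.
have v0 : 0 < v by rewrite divr_gt0// mulr_gt0// exprn_gt0.
(* The bias takes at most half of [l * t]; this [l] minimises l^2 v - l t/2, with value -t^2/(16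
   v). *)
pose l := t / (4 * v); have l0 : 0 <= l by rewrite divr_ge0// mulr_ge0// ltW.
have := @pr_le_avg (fun h => mu #|X| + t <= #|occupied h X|%:R)
  (fun h => expR (l * #|occupied h X|%:R)) (expR (l * (mu #|X| + t))).
move=> /(_ (expR_gt0 _) (fun=> expR_ge0 _) _)/le_trans; apply.
  by move=> h hh; rewrite ler_expR ler_wpM2l.
rewrite ler_pdivrMr ?expR_gt0//.
have /= mgf := mgf_occupied (leqnn _) Xn l0.
apply: (le_trans mgf); rewrite -/g.
rewrite -expRD ler_expR.
have -> : g * #|X|%:R * #|X|%:R / n = v by rewrite /v; ring.
have hl : l * (g * #|X|%:R / n) <= l * (t / 2).
  by rewrite ler_wpM2l//; lra.
have e1 : l * t / 2 = t ^+ 2 / v / 8 by rewrite /l; field; rewrite lt0r_neq0.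
have e2 : l ^+ 2 * v = t ^+ 2 / v / 16 by rewrite /l; field; rewrite lt0r_neq0.
rewrite e2; move: (mu _) (g * _ / n) (t ^+ 2 / v) hl e1 => a b w; lra.
Qed.

End Concentration.

(** * Bit vectors under XOR, and the upper bound on the mean *)

HB.instance Definition _ (r : nat) := Finite.copy (hval r) {ffun 'I_r -> bool}.
HB.instance Definition _ (r : nat) :=
  GRing.Zmodule.copy (hval r) {ffun 'I_r -> bool}.

Section MeanUpperBound.
Context {R : realType} {c s r : nat}.
Hypothesis c_gt0 : (0 < c)%N.

Notation V := (hval r).
Notation tab := {ffun 'I_c -> {ffun 'I_s -> V}}.
Implicit Types (X : {set key c s}) (h : tab) (d u v : V).

Let p0 : 'I_c := Ordinal c_gt0.

Lemma hvalDE u v (i : 'I_r) : (u + v) i = u i (+) v i.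
Proof. by rewrite ffunE. Qed.

Lemma hvalDD v : v + v = 0.
Proof. by apply/ffunP => i; rewrite hvalDE addbb ffunE. Qed.

Lemma hvalMnDb d (a b : bool) : d *+ (a (+) b) = d *+ a + d *+ b.
Proof. by case: a b => [] [] /=; rewrite ?addr0 ?add0r// hvalDD. Qed.

Lemma hash_bit h (y : key c s) (j : 'I_r) :
  hash h y j = \big[addb/false]_i (h i (y i) j).
Proof.
rewrite /hash (big_morph (fun v : V => v j) (fun u v => hvalDE u v j) (id1 := false))//.
by rewrite ffunE.
Qed.

Definition nonzero_on X : {set tab} := [set h | [forall x in X, hash h x != 0]].

Section ShiftToNonzero.
Variables (X : {set key c s}) (x : key c s) (d : V) (j : 'I_r).
Hypothesis dj : d j.

Let A0 : {set tab} := [set h in nonzero_on X | hash h x == 0].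
Let Ad : {set tab} := [set h in nonzero_on X | hash h x == d].

(** Additive choice of representative modulo {0, d}: the one whose bit [j] is zero. *)
Let clear_bit v : V := v + d *+ v j.
Let clear_tab h : tab := [ffun i => [ffun a => clear_bit (h i a)]].

Lemma clear_bitD u v : clear_bit (u + v) = clear_bit u + clear_bit v.
Proof. by rewrite /clear_bit hvalDE hvalMnDb addrACA. Qed.

Lemma clear_bitMn (b : bool) : clear_bit (d *+ b) = 0.
Proof.
case: b; rewrite /clear_bit ?mulr0n ?mulr1n; first by rewrite dj hvalDD.
by rewrite ffunE addr0.
Qed.

Lemma hash_clear h y : hash (clear_tab h) y = clear_bit (hash h y).
Proof.
have bit0 : clear_bit 0 = 0 := clear_bitMn false.
rewrite /hash (big_morph clear_bit clear_bitD bit0).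
by apply: eq_bigr => i _; rewrite !ffunE.
Qed.

(** One reference element of [A0] per fibre of [clear_tab]; the default 0 is never reached from
    [A0]. *)
Let rep (k : tab) : tab := odflt 0 [pick h in A0 | clear_tab h == k].

(* For h' in A0 with the same cleared version as h, adding d times the j-th bits
   of h' and d once more at position p0 changes each hash value v of h into
   v + d * ~~ v' j, where v' is the hash value of h'. *)
Let move_tab h : tab :=
  [ffun i => [ffun a =>
     h i a + d *+ (rep (clear_tab h) i a j (+) (i == p0))]].

Lemma repP h : h \in A0 ->
  rep (clear_tab h) \in A0 /\ clear_tab (rep (clear_tab h)) = clear_tab h.
Proof.
move=> hA; rewrite /rep; case: pickP => [h' /andP[h'A /eqP]//|/(_ h)].
by rewrite hA eqxx.
Qed.

Lemma clear_move h : clear_tab (move_tab h) = clear_tab h.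
Proof.
apply/ffunP => i; apply/ffunP => a.
by rewrite !ffunE clear_bitD clear_bitMn addr0.
Qed.

Lemma hash_move h y :
  hash (move_tab h) y = hash h y + d *+ ~~ hash (rep (clear_tab h)) y j.
Proof.
have e : true = \big[addb/false]_(i < c) (i == p0).
  by rewrite (bigD1 p0)// eqxx big1// => i /negbTE.
rewrite -addbT hash_bit [X in _ (+) X]e.
rewrite -big_split /=.
rewrite (big_morph (fun b : bool => d *+ b) (hvalMnDb d)
  (mulr0n d : d *+ false = 0)).
rewrite /hash -big_split /=; apply: eq_bigr => i _.
by rewrite !ffunE.
Qed.

(** [move_tab] preserves fibres of [clear_tab], and within a fibre it is a translation. *)
Lemma move_tab_inj : {in A0 &, injective move_tab}.
Proof.
move=> h1 h2 _ _ e; have ec : clear_tab h1 = clear_tab h2.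
  by rewrite -clear_move e clear_move.
apply/ffunP => i; apply/ffunP => a.
have := congr1 (fun h : tab => h i a) e; rewrite !ffunE ec.
exact: addIr.
Qed.

(** A value v on [X] can only become 0 if v = d and the reference value v' has bit [j] clear. Then
    v' = [clear_bit] v = 0, contradicting that v' is nonzero. *)
Lemma move_tab_in h : h \in A0 -> move_tab h \in Ad.
Proof.
move=> hA; have [] := repP hA; set h' := rep _ => h'A clr.
move: (hA) (h'A); rewrite !inE => /andP[/forall_inP hX /eqP hx].
move=> /andP[/forall_inP h'X /eqP h'x].
apply/andP; split; last by rewrite hash_move hx -/h' h'x ffunE mulr1n add0r.
apply/forall_inP => y yX; rewrite hash_move -/h'.
have := congr1 (fun k : tab => hash k y) clr; rewrite !hash_clear /clear_bit.
case: (boolP (hash h' y j)) => [_ _|_]; first by rewrite mulr0n addr0 hX.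
rewrite mulr0n addr0 => e; apply: contraNneq (h'X y yX) => h0.
have hd : hash h y = d by rewrite -[LHS](addrK d) h0 sub0r -[LHS]addr0 -(hvalDD d) addKr.
by rewrite e hd dj hvalDD.
Qed.

Lemma card_hash0_le : (#|A0| <= #|Ad|)%N.
Proof.
rewrite -(card_in_imset move_tab_inj); apply/subset_leq_card/fintype.subsetP => k.
by case/imsetP => h hA ->; apply: move_tab_in.
Qed.

End ShiftToNonzero.

(** Among the [#|V|] fibres of [hash h x], the one over 0 is the smallest. *)
Lemma card_nonzero_on_step X x :
  (#|V| * #|[set h in nonzero_on X | hash h x == 0%R]| <= #|nonzero_on X|)%N.
Proof.
rewrite -[leqRHS]sum1_card (partition_big (fun h : tab => hash h x) predT)//=.
rewrite -sum_nat_const; apply: leq_sum => d _.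
have -> : (\sum_(h in nonzero_on X | hash h x == d) 1)%N =
    #|[set h in nonzero_on X | hash h x == d]|.
  by rewrite -sum1_card; apply: eq_bigl => h; rewrite inE.
have [->//|d0] := eqVneq d 0.
have [j dj] : exists j, d j.
  apply/existsP; apply: contraNT d0 => /existsPn dN.
  by apply/eqP/ffunP => j; rewrite ffunE; apply/negbTE/dN.
exact: (card_hash0_le X x dj).
Qed.

(** Add keys one at a time: each misses bin 0 with conditional probability at least 1 - 1/n. *)
Lemma pr_nonzero_on_ge X :
  (1 - (#|V|%:R)^-1) ^+ #|X| <= avg (fun h => (h \in nonzero_on X)%:R) :> R.
Proof.
have n0 : (0 : R) < #|V|%:R := card_zmod_gt0.
have p0' : 0 <= 1 - (#|V|%:R)^-1 :> R.
  by rewrite subr_ge0 invf_le1// ler1n; apply/card_gt0P; exists 0.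
have [k] := ubnP #|X|; elim: k X => // k IH X.
have [-> _|[x xX]] := set_0Vmem X.
  rewrite cards0 expr0 (@eq_avg _ _ _ (fun=> 1)) ?(avg_cst (0 : tab))// => h.
  by rewrite (_ : h \in _)// inE; apply/forall_inP => x; rewrite inE.
rewrite (cardsD1 x) xX add1n ltnS => Xk.
set Y := X :\ x in Xk *.
have hE h : (h \in nonzero_on X)%:R =
    (h \in nonzero_on Y)%:R - (h \in [set h in nonzero_on Y | hash h x == 0])%:R :> R.
  rewrite !inE -(finset.setD1K xX) -/Y.
  have -> : [forall y in x |: Y, hash h y != 0] =
      (hash h x != 0) && [forall y in Y, hash h y != 0].
    apply/forall_inP/andP => [hX|[hx /forall_inP hY] y].
      split; first by rewrite hX// !inE eqxx.
      by apply/forall_inP => y yY; rewrite hX// inE yY orbT.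
    by rewrite inE => /orP[/finset.set1P ->//|/hY].
  by case: eqP; case: [forall y in Y, _]; rewrite /= ?subrr ?subr0.
rewrite (eq_avg hE) avgB.
have step : avg (fun h => (h \in [set h in nonzero_on Y | hash h x == 0])%:R) <=
    (#|V|%:R)^-1 * avg (fun h => (h \in nonzero_on Y)%:R) :> R.
  rewrite !avg_mem mulrA ler_wpM2r ?invr_ge0// mulrC ler_pdivlMr// -natrM ler_nat.
  by rewrite mulnC card_nonzero_on_step.
have := ler_wpM2l p0' (IH Y Xk); rewrite -exprS => /le_trans; apply.
by rewrite mulrBl mul1r lerD2l lerN2.
Qed.

Lemma avg_card_occupied_le X :
  avg (fun h => #|occupied h X|%:R) <= @mean_random R (hval r) #|X|.
Proof.
have n0 : (0 : R) < #|V|%:R := card_zmod_gt0.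
under eq_avg do rewrite card_occupied.
rewrite avgZl ler_pM2l// avgB (avg_cst (0 : tab)) lerD2l lerN2.
apply: (le_trans (pr_nonzero_on_ge X)).
rewrite exchange_avg -[leLHS](avg_cst (0 : V)); apply: ler_avg => y.
(* Adding the constant y to table [p0] moves bin 0 to bin y. *)
rewrite [leRHS](avg_shifts tt (fun=> only_table p0 [ffun=> y])).
apply: ler_avg => h; rewrite (avg_cst tt) ler_nat inE.
case: (boolP [forall z in X, _]) => // /forall_inP hX.
rewrite (_ : avoids _ _ _ _)//; apply/forall_inP => x xX.
have -> : hash (h + only_table p0 [ffun=> y]) x = hash h x + y.
  by rewrite hash_addD hash_only_table ffunE.
by rewrite addrK inE hX.
Qed.

End MeanUpperBound.

(** * Transfer to [tabhash] and conclusion *)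

Lemma tabhashE (c s r : nat) (h : tabfun c s r) (x : key c s) :
  tabhash h x = hash h x.
Proof. by apply/ffunP => b; rewrite ffunE hash_bit. Qed.

Lemma image_sizeE (c s r : nat) (h : tabfun c s r) (X : {set key c s}) :
  image_size h X = #|occupied h X|.
Proof.
rewrite /image_size /occupied; congr #|pred_of_set _|.
by apply: eq_imset => x; apply: tabhashE.
Qed.

Lemma card_hval (r : nat) : #|hval r| = (2 ^ r)%N.
Proof. by rewrite card_ffun card_bool card_ord. Qed.

Lemma probE (R : realType) (c s r : nat) (E : pred (tabfun c s r)) :
  prob R E = pr E.
Proof.
rewrite /prob /pr -avg_mem; apply: eq_avg => h.
by rewrite inE.
Qed.

(** The tails are proved with the quadratic branch, which is at least the minimum. *)
Lemma tail_exponent_le (R : realType) (c n m : nat) (t : R) : (0 < m)%N ->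
  tail_exponent c n m t <=
    t ^+ 2 / (m%:R `^ (1 - c%:R^-1) * m%:R ^+ 2 / n%:R).
Proof.
move=> m0; rewrite /tail_exponent ge_min; apply/orP; left.
rewrite -[m%:R ^+ 2]powR_mulrn// -powRD; last by rewrite pnatr_eq0 -lt0n m0 implybT.
by have -> : 1 - c%:R^-1 + 2%:R = 3 - c%:R^-1 :> R by ring.
Qed.

(** Degenerate inputs: as division by 0 yields 0, the quadratic branch vanishes and the claimed
    bounds are at least 1. *)
Lemma tail_exponent_le0 (R : realType) (c n m : nat) (t : R) : (0 < c)%N ->
  (m == 0)%N || (t == 0) -> tail_exponent c n m t <= 0.
Proof.
move=> c0 mt; rewrite /tail_exponent ge_min; apply/orP; left.
case/orP: mt => /eqP ->; last by rewrite expr0n mul0r.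
rewrite powR0 ?mul0r ?invr0 ?mulr0//.
have : c%:R^-1 <= 1 :> R by rewrite invf_le1 ?ltr0n// ler1n.
by move=> c1; rewrite lt0r_neq0//; lra.
Qed.

(** Cantelli gives 1 - t^2/(k + t^2) <= exp(-t^2/(k + t^2)). Here k <= K v, and t <= 2B gives t^2 <=
    4 v g/n <= 4 v, so k + t^2 <= (K + 4) v. *)
Lemma occupied_upper_tail_small (R : realType) (c s r : nat) (X : {set key c s})
    (K t : R) : (0 < c)%N -> (0 < #|X|)%N -> (#|X| <= #|hval r|)%N ->
  let n : R := #|hval r|%:R in
  let g : R := #|X|%:R `^ (1 - c%:R^-1) in
  0 < t -> t <= 2 * (g * #|X|%:R / n) -> 0 < K ->
  avg (fun h : tabfun c s r =>
    (#|occupied h X|%:R - @mean_random R (hval r) #|X|) ^+ 2) <= K * (#|X|%:R ^+ 2 / n) ->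
  pr (fun h : tabfun c s r => @mean_random R (hval r) #|X| + t <= #|occupied h X|%:R)
  <= expR (- ((K + 4)^-1 * (t ^+ 2 / (g * #|X|%:R ^+ 2 / n)))).
Proof.
move=> c0 X0 Xn n g t0 tB K0 msq.
have n0 : 0 < n := card_zmod_gt0.
have m1 : 1 <= #|X|%:R :> R by rewrite ler1n.
have m0 : 0 < #|X|%:R :> R by rewrite ltr0n.
have mn : #|X|%:R <= n by rewrite ler_nat.
have ci0 : 0 <= c%:R^-1 :> R by rewrite invr_ge0.
have ci1 : c%:R^-1 <= 1 :> R by rewrite invf_le1 ?ltr0n// ler1n.
have g1 : 1 <= g by rewrite -[leLHS](powRr0 #|X|%:R) ler_powR//; lra.
have gm : g <= #|X|%:R by rewrite -[leRHS]powRr1// ler_powR//; lra.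
have := @occupied_cantelli R (hval r) c s X (K * (#|X|%:R ^+ 2 / n)) t t0.
have K0' : 0 < K * (#|X|%:R ^+ 2 / n) by rewrite mulr_gt0// divr_gt0// exprn_gt0.
move=> /(_ K0' (avg_card_occupied_le c0 X) msq)/le_trans; apply.
clearbody n g; set k := K * _ in K0' *; set v := g * _ / n.
have v0 : 0 < v by rewrite divr_gt0// mulr_gt0 ?exprn_gt0//; lra.
have kv : k <= K * v.
  rewrite ler_wpM2l ?(ltW K0)// ler_wpM2r ?invr_ge0 ?(ltW n0)//.
  by rewrite ler_peMl// sqr_ge0.
have tv : t ^+ 2 <= 4 * v.
  apply: (@le_trans _ _ ((2 * (g * #|X|%:R / n)) ^+ 2)).
    by rewrite lerXn2r// nnegrE; lra.
  have -> : (2 * (g * #|X|%:R / n)) ^+ 2 = 4 * v * (g / n).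
    by rewrite /v; field; rewrite lt0r_neq0.
  rewrite ler_piMr//; first by lra.
  by rewrite ler_pdivrMr// mul1r; lra.
have t2 : 0 < t ^+ 2 by rewrite exprn_gt0.
have kt : 0 < k + t ^+ 2 by lra.
have -> : k / (k + t ^+ 2) = 1 + - (t ^+ 2 / (k + t ^+ 2)).
  by field; rewrite lt0r_neq0.
rewrite (le_trans (expR_ge1Dx _))// ler_expR lerN2.
rewrite mulrCA ler_wpM2l ?(ltW t2)// -invfM lef_pV2 ?posrE//.
  2: by rewrite mulr_gt0//; lra.
lra.
Qed.

Unset Implicit Arguments.

Theorem theorem4 (R : realType) (c : nat) (hc : (0 < c)%N) :
  exists (a b : R), 0 < a /\ 0 <= b /\
  forall (s r : nat) (X : {set key c s}) (t : R),
    (#|X| <= 2 ^ r)%N -> 0 <= t ->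
    prob R (fun h : tabfun c s r =>
              mu0 R (2 ^ r) #|X| + t <= (image_size h X)%:R)
      <= expR (- (a * tail_exponent c (2 ^ r) #|X| t))
    /\
    prob R (fun h : tabfun c s r =>
              (image_size h X)%:R <= mu0 R (2 ^ r) #|X| - t)
      <= expR (- (a * tail_exponent c (2 ^ r) #|X| t))
         + b * ((#|X| ^ 2)%:R / ((2 ^ r)%:R * t ^+ 2)).
Proof.
pose K : R := (bias_const c 2 + 1 + 2 * bias_const c 1)%:R.
have K0 : 0 < K by rewrite ltr0n addnAC addn1.
(* The two rates come from the regimes of large and small t. *)
pose a : R := Num.min 16^-1 (K + 4)^-1.
have a0 : 0 < a by rewrite lt_min !invr_gt0; lra.
exists a, K; split=> //; split; first exact: ltW.
move=> s r X t Xr t0; rewrite !probE.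
have -> : pr (fun h : tabfun c s r => mu0 R (2 ^ r) #|X| + t <= (image_size h X)%:R)
   = pr (fun h : tabfun c s r =>
       @mean_random R (hval r) #|X| + t <= #|occupied h X|%:R) :> R.
  by apply: eq_avg => h; rewrite image_sizeE /mean_random card_hval.
have -> : pr (fun h : tabfun c s r => (image_size h X)%:R <= mu0 R (2 ^ r) #|X| - t)
   = pr (fun h : tabfun c s r =>
       #|occupied h X|%:R <= @mean_random R (hval r) #|X| - t) :> R.
  by apply: eq_avg => h; rewrite image_sizeE /mean_random card_hval.
rewrite -card_hval in Xr *.
have msq := @card_occupied_msq R (hval r) c s X; rewrite -/K in msq.
have trivial_case (E : pred (tabfun c s r)) : (#|X| == 0)%N || (t == 0) ->
    pr E <= expR (- (a * tail_exponent c #|hval r| #|X| t)).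
  move=> mt; rewrite (le_trans (pr_le1 E))// -[leLHS]expR0 ler_expR oppr_ge0.
  by rewrite pmulr_rle0// tail_exponent_le0.
split.
  have [mt|] := boolP ((#|X| == 0)%N || (t == 0)); first exact: trivial_case.
  rewrite negb_or -lt0n => /andP[X0 tN0].
  have {tN0}t_gt0 : 0 < t by rewrite lt_def tN0.
  have tail := tail_exponent_le c #|hval r| t X0.
  set w := (_ / _) in tail.
  have w0 : 0 <= w.
    by rewrite divr_ge0 ?sqr_ge0// divr_ge0// mulr_ge0 ?sqr_ge0// powR_ge0.
  have le_exp (k : R) : a <= k ->
      expR (- (k * w)) <= expR (- (a * tail_exponent c #|hval r| #|X| t)).
    move=> ak; rewrite ler_expR lerN2 (le_trans (ler_wpM2l (ltW a0) tail))//.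
    by rewrite ler_wpM2r.
  have [tB|/ltW tB] := leP (2 * (#|X|%:R `^ (1 - c%:R^-1) * #|X|%:R / #|hval r|%:R)) t.
    rewrite (le_trans (occupied_upper_tail_large hc X0 Xr t0 tB))//.
    by apply: le_exp; rewrite /a ge_min lexx.
  rewrite (le_trans (occupied_upper_tail_small hc X0 Xr t_gt0 tB K0 msq))//.
  by apply: le_exp; rewrite /a ge_min lexx orbT.
(* At t = 0 the Chebyshev term is 0 by convention, so the exponential must bound the probability
   alone. *)
have [tE|tN0] := eqVneq t 0.
  rewrite (le_trans (trivial_case _ _)) ?tE ?eqxx ?orbT//.
  by rewrite expr0n mulr0 invr0 !mulr0 addr0.
have t_gt0 : 0 < t by rewrite lt_def tN0.
rewrite (le_trans (occupied_chebyshev t_gt0 msq))//.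
rewrite -[leLHS]add0r lerD ?expR_ge0// -mulrA natrX ler_wpM2l ?(ltW K0)//.
by rewrite -mulrA -invfM.
Qed.
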